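(* Let $\delta\ge 0$, let $(X,d)$ be a proper $\delta$-hyperbolic geodesic space, and let $f:X\to\mathbb{R}$ be a $K$-convex $L$-Lipschitz function with $K\ge 0$ and $L>0$ such that $\inf_X f$ is attained at some $p\in X$. Then, for any $x\in X$, any $\tau>0$, and any $y\in \mathsf{J}^f_\tau(x)$, we have \[ d(p,y)\le d(p,x)-d(x,y)+\frac{4\sqrt{2\tau L\delta}}{\sqrt{K\tau+1}}. \] Moreover, in the case $K>0$ and $\tau>K^{-1}$, we further have \[ d(p,y)\le d(p,x)-\left(1-\frac{1}{K\tau}\right)\frac{f(x)-f(p)}{L}+\frac{4\sqrt{2\tau L\delta}}{\sqrt{K\tau+1}}. \]
   Context: Let $(X,d)$ be a metric space. Proper: every bounded closed subset of $X$ is compact. Geodesic space: any two points $x,y\in X$ are joined by a (minimal) geodesic, i.e. a map $\gamma:[0,\ell]\to X$ with $\gamma(0)=x$, $\gamma(\ell)=y$ and $d(\gamma(s),\gamma(t))=(|s-t|/\ell)\,d(x,y)$ for all $s,t\in[0,\ell]$. Gromov product: $(x|y)_p:=\frac12\{d(p,x)+d(p,y)-d(x,y)\}$. The space $(X,d)$ is $\delta$-hyperbolic ($\delta\ge0$) if $(x|z)_p\ge\min\{(x|y)_p,(y|z)_p\}-\delta$ for all $p,x,y,z\in X$. $L$-Lipschitz: $|f(x)-f(y)|\le L\,d(x,y)$ for all $x,y\in X$. $K$-convex (in the weak geodesic sense): for any $x,y\in X$ there is some geodesic $\gamma:[0,1]\to X$ from $x$ to $y$ such that $f(\gamma(t))\le(1-t)f(x)+tf(y)-\frac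 K2(1-t)t\,d^2(x,y)$ for all $t\in[0,1]$. Proximal (resolvent) operator: for $\tau>0$ and $x\in X$, $\mathsf{J}^f_\tau(x)$ is the set of all minimizers over $y\in X$ of $y\mapsto f(y)+\frac{d^2(x,y)}{2\tau}$. *)

(* Defs.v *)
From mathcomp Require Import all_boot all_order all_algebra.
From mathcomp Require Import all_classical all_reals all_analysis.

Set Implicit Arguments.
Unset Strict Implicit.
Unset Printing Implicit Defensive.

Import Order.TTheory GRing.Theory Num.Theory.

Local Open Scope classical_set_scope.
Local Open Scope ring_scope.

(* The library's [bounded_set] is restricted to normed modules. *)
Definition metric_bounded (R : realType) (X : metricType R) (A : set X) : Prop :=
  exists M : R, forall x y : X, A x -> A y -> mdist x y <= M.

Definition proper_space (R : realType) (X : metricType R) : Prop :=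
  forall A : set X, metric_bounded A -> closed A -> compact A.

(* Only the values of [g] on [0, l] are constrained. *)
Definition is_geodesic (R : realType) (X : metricType R)
    (l : R) (x y : X) (g : R -> X) : Prop :=
  [/\ g 0 = x, g l = y &
      forall s t : R, 0 <= s <= l -> 0 <= t <= l ->
        mdist (g s) (g t) = `|s - t| / l * mdist x y].

Definition geodesic_space (R : realType) (X : metricType R) : Prop :=
  forall x y : X, exists (l : R) (g : R -> X), 0 < l /\ is_geodesic l x y g.

Definition gromov_product (R : realType) (X : metricType R) (p x y : X) : R :=
  2^-1 * (mdist p x + mdist p y - mdist x y).

Definition hyperbolic_space (R : realType) (X : metricType R) (delta : R) : Prop :=
  forall p x y z : X,
    Num.min (gromov_product p x y) (gromov_product p y z) - delta
      <= gromov_product p x z.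

(* The library's [lipschitz] predicates are restricted to normed modules. *)
Definition metric_lipschitz (R : realType) (X : metricType R)
    (L : R) (f : X -> R) : Prop :=
  forall x y : X, `|f x - f y| <= L * mdist x y.

Definition weakly_convex (R : realType) (X : metricType R)
    (K : R) (f : X -> R) : Prop :=
  forall x y : X, exists2 g : R -> X, is_geodesic 1 x y g &
    forall t : R, 0 <= t <= 1 ->
      f (g t) <= (1 - t) * f x + t * f y
                 - K / 2 * (1 - t) * t * mdist x y ^+ 2.

Definition minimizers (R : realType) (X : Type) (f : X -> R) : set X :=
  [set y | forall z : X, f y <= f z].

Definition resolvent (R : realType) (X : metricType R)
    (f : X -> R) (tau : R) (x : X) : set X :=
  minimizers (fun y : X => f y + mdist x y ^+ 2 / (2 * tau)).

(* Main.v *)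
Require Import Defs.
From mathcomp Require Import all_boot all_order all_algebra.
From mathcomp Require Import all_classical all_reals all_analysis.
From mathcomp Require Import ring lra.

(** Let [r = (x|p)_y] and let [z] be the point at distance [r] from [y] on the
    geodesic from [y] to [p] along which [f] is convex.  Hyperbolicity gives
    [d(x,z) <= d(x,y) - r + 2 delta], while [f z <= f y] because [p] minimizes
    [f]; minimality of [y] for the resolvent functional then forces
    [r <= 2 delta].  Comparing [y] with the midpoint of a geodesic from [y] to
    [x] gives [d(x,y) <= 4 tau L / (K tau + 1)].  Since also [r <= d(x,y)],
    [r^2 <= 2 delta d(x,y)], which is the first inequality.  The second follows
    from it by bounding [d(x,y)] below through the Lipschitz condition and the
    quadratic growth of [f] away from [p]. *)

Set Implicit Arguments.
Unset Strict Implicit.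
Unset Printing Implicit Defensive.

Import Order.TTheory GRing.Theory Num.Theory.

Local Open Scope classical_set_scope.
Local Open Scope ring_scope.

Lemma geodesic01_dist (R : realType) (X : metricType R) (x y : X) (g : R -> X)
    (t : R) : is_geodesic 1 x y g -> 0 <= t <= 1 ->
  mdist x (g t) = t * mdist x y /\ mdist (g t) y = (1 - t) * mdist x y.
Proof.
move=> [g0 g1 gd] /andP[t0 t1].
have d0 : mdist (g 0) (g t) = `|0 - t| / 1 * mdist x y.
  by apply: gd; apply/andP; split; lra.
have d1 : mdist (g t) (g 1) = `|t - 1| / 1 * mdist x y.
  by apply: gd; apply/andP; split; lra.
move: d0 d1; rewrite g0 g1 sub0r normrN ger0_norm// distrC ger0_norm ?subr_ge0//.
by rewrite !divr1.
Qed.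

Lemma gromov_product_ge0 (R : realType) (X : metricType R) (p x y : X) :
  0 <= gromov_product p x y.
Proof.
rewrite /gromov_product; have := metric_triangle x p y.
by rewrite (metric_sym x p); lra.
Qed.

Lemma gromov_product_le (R : realType) (X : metricType R) (p x y : X) :
  gromov_product p x y <= mdist p x.
Proof.
rewrite /gromov_product; have := metric_triangle p x y; lra.
Qed.

Lemma gromov_productC (R : realType) (X : metricType R) (p x y : X) :
  gromov_product p x y = gromov_product p y x.
Proof. by rewrite /gromov_product (metric_sym x y); lra. Qed.

(** Otherwise the convexity bound along a geodesic from [p] to [x] would fall below [f p] at small
    positive times. *)
Lemma weakly_convex_min_growth (R : realType) (X : metricType R) (K : R)
    (f : X -> R) (p x : X) :
  weakly_convex K f -> minimizers f p ->
  K / 2 * mdist p x ^+ 2 <= f x - f p.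
Proof.
move=> cvx fmin; rewrite leNgt; apply/negP => gap.
set A := K / 2 * mdist p x ^+ 2 in gap.
have D0 : f p <= f x := fmin x.
have A0 : 0 < A by lra.
(* Half the time at which [f x - f p - (1 - t) * A] vanishes, so this factor is still negative. *)
pose t := (A - (f x - f p)) / (2 * A).
have tA : t * A = (A - (f x - f p)) / 2 by rewrite /t; field; lra.
have t0 : 0 < t by rewrite divr_gt0//; lra.
have t1 : t <= 1 by rewrite ler_pdivrMr; lra.
have [g _ gcvx] := cvx p x.
have := gcvx t; rewrite (ltW t0) t1 => /(_ isT) ft.
have fpt : f p <= f (g t) := fmin _.
have : t * (f x - f p - (1 - t) * A) >= 0.
  by rewrite /A; nra.
by rewrite pmulr_rge0// mulrBl mul1r tA; lra.
Qed.

Lemma resolvent_dist_le (R : realType) (X : metricType R) (K L tau : R)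
    (f : X -> R) (x y : X) :
  0 <= K -> 0 < L -> 0 < tau ->
  weakly_convex K f -> metric_lipschitz L f -> resolvent f tau x y ->
  mdist x y * (K * tau + 1) <= 4 * (tau * L).
Proof.
move=> K0 L0 tau0 cvx lip res.
have [g geo gcvx] := cvx y x.
have half01 : 0 <= (2^-1 : R) <= 1 by apply/andP; split; lra.
have [_ dgx] := geodesic01_dist geo half01.
have := gcvx _ half01; have := res (g 2^-1) => /=.
rewrite (metric_sym x (g _)) dgx !(metric_sym y x).
have := lip x y; rewrite ler_norml => /andP[_ fxy].
set a := mdist x y in fxy *.
have a0 : 0 <= a := mdist_ge0 x y.
set u := (2 * tau)^-1 => resz fz.
have uE : u * (2 * tau) = 1 by rewrite mulVf; lra.
have [->|an0] := eqVneq a 0; first by rewrite mul0r; nra.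
have ap : 0 < a by rewrite lt_neqAle eq_sym an0.
(* Four times the sum of [resz] and [fz], with [f x - f y <= L * a]; one factor [a] is kept apart
   for cancellation. *)
have ineq : a * (3 * u * a + K * a / 2) <= a * (2 * L) by nra.
move: ineq; rewrite ler_pM2l// => ineq.
have : (3 * u * a + K * a / 2) * (2 * tau) <= 2 * L * (2 * tau).
  by rewrite ler_wpM2r//; lra.
have -> : (3 * u * a + K * a / 2) * (2 * tau)
   = 3 * a * (u * (2 * tau)) + K * a * tau by field.
by rewrite uE; nra.
Qed.

Lemma resolvent_gromov_product_le (R : realType) (X : metricType R)
    (delta K tau : R) (f : X -> R) (p x y : X) :
  0 <= delta -> hyperbolic_space X delta -> 0 <= K -> 0 < tau ->
  weakly_convex K f -> minimizers f p -> resolvent f tau x y ->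
  gromov_product y x p <= 2 * delta.
Proof.
move=> delta0 hyp K0 tau0 cvx fmin res; rewrite leNgt; apply/negP => rgt.
set r := gromov_product y x p in rgt.
have ra : r <= mdist x y by rewrite (metric_sym x) gromov_product_le.
have rb : r <= mdist y p by rewrite /r gromov_productC gromov_product_le.
have [g geo gcvx] := cvx y p.
set b := mdist y p in rb gcvx.
have b0 : 0 < b by lra.
have t01 : 0 <= r / b <= 1.
  by rewrite ler_pdivrMr// divr_ge0; lra.
have [dyz dzp] := geodesic01_dist geo t01.
have := gcvx _ t01; have := res (g (r / b)).
move: dyz dzp; set z := g (r / b); rewrite -/b mulrBl mul1r divfK ?gt_eqF//.
move=> dyz dzp /= resz fz.
(* The convexity bound is at most a convex combination of [f y] and [f p], and [f p <= f y]. *)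
have fzy : f z <= f y.
  have fpy : f p <= f y := fmin y.
  move: fz t01; move: (r / b) => t fz /andP[t0 t1].
  have : 0 <= K / 2 * (1 - t) * t * b ^+ 2.
    have t1' : 0 <= 1 - t by rewrite subr_ge0.
    by rewrite !mulr_ge0 ?invr_ge0 ?(ltW b0).
  by nra.
have zpr : gromov_product y p z = r.
  by rewrite /gromov_product dyz (metric_sym p z) dzp -/b; lra.
(* Both products in the minimum equal [r], since [z] lies on a geodesic from [y] to [p]. *)
have := hyp y x p z; rewrite zpr -/r minxx.
rewrite {1}/gromov_product dyz (metric_sym y x) => dxz.
have {}dxz : mdist x z <= mdist x y - (r - 2 * delta) by lra.
(* Minimality of [y] and [fzy] give this, yet [r > 2 * delta] makes [z] strictly closer to [x]. *)
have : mdist x y ^+ 2 / (2 * tau) <= mdist x z ^+ 2 / (2 * tau) by lra.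
have xz0 := mdist_ge0 x z.
by rewrite ler_pM2r ?invr_gt0; nra.
Qed.

Theorem theorem1p1 (R : realType) (X : metricType R) (delta K L : R)
  (f : X -> R) (p : X) :
  0 <= delta ->
  proper_space X -> hyperbolic_space X delta -> geodesic_space X ->
  0 <= K -> 0 < L ->
  weakly_convex K f -> metric_lipschitz L f ->
  minimizers f p ->
  forall (x : X) (tau : R) (y : X), 0 < tau -> resolvent f tau x y ->
    mdist p y <= mdist p x - mdist x y
                 + 4 * Num.sqrt (2 * tau * L * delta) / Num.sqrt (K * tau + 1)
    /\
    (0 < K -> K^-1 < tau ->
     mdist p y <= mdist p x - (1 - 1 / (K * tau)) * ((f x - f p) / L)
                  + 4 * Num.sqrt (2 * tau * L * delta) / Num.sqrt (K * tau + 1)).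
Proof.
move=> delta0 _ hyp _ K0 L0 cvx lip fmin x tau y tau0 res.
have first : mdist p y <= mdist p x - mdist x y
    + 4 * Num.sqrt (2 * tau * L * delta) / Num.sqrt (K * tau + 1).
  have q0 : 0 < K * tau + 1 by nra.
  have r2d := resolvent_gromov_product_le delta0 hyp K0 tau0 cvx fmin res.
  have aub := resolvent_dist_le K0 L0 tau0 cvx lip res.
  have r0 := gromov_product_ge0 y x p.
  have ra := gromov_product_le y x p.
  have rE : mdist p y = mdist p x - mdist x y + 2 * gromov_product y x p.
    rewrite /gromov_product (metric_sym y x) (metric_sym y p) (metric_sym x p).
    by lra.
  move: rE r2d r0 ra; rewrite (metric_sym y x).
  set r := gromov_product y x p => -> r2d r0 ra.
  rewrite lerD2l -mulrA -sqrtrV ?(ltW q0)// -sqrtrM; last first.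
    by rewrite !mulr_ge0//; lra.
  suff : r <= 2 * Num.sqrt (2 * tau * L * delta / (K * tau + 1)) by lra.
  rewrite -ler_pdivrMl//.
  (* One factor [r] is bounded by [2 * delta], the other by [mdist x y]. *)
  have r2 : r ^+ 2 <= 2 * delta * mdist x y by rewrite expr2 ler_pM.
  have sq : (2^-1 * r) ^+ 2 <= 2 * tau * L * delta / (K * tau + 1).
    rewrite ler_pdivlMr//.
    have : r ^+ 2 * (K * tau + 1) <= 2 * delta * mdist x y * (K * tau + 1).
      by rewrite ler_pM2r.
    have : 2 * delta * (mdist x y * (K * tau + 1)) <= 2 * delta * (4 * (tau * L)).
      by rewrite ler_wpM2l// mulr_ge0.
    have -> : (2^-1 * r) ^+ 2 * (K * tau + 1) = r ^+ 2 * (K * tau + 1) / 4.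
      by field.
    by lra.
  by apply: le_trans (ler_wsqrtr sq); rewrite sqrtr_sqr ler_norm.
split=> // Kp _; apply: (le_trans first); rewrite lerD2r lerD2l lerN2.
have growth := weakly_convex_min_growth x cvx fmin.
have Kt0 : 0 < K * tau by exact: mulr_gt0.
(* Test the resolvent functional at [p], then bound [mdist p x ^+ 2] by quadratic growth. *)
have resp : f y - f p <= (f x - f p) / (K * tau).
  have := res p; rewrite /= (metric_sym x p) => rp.
  have : 0 <= mdist x y ^+ 2 / (2 * tau).
    by rewrite divr_ge0 ?sqr_ge0//; lra.
  have : mdist p x ^+ 2 / (2 * tau) <= (f x - f p) / (K * tau).
    rewrite ler_pdivlMr//.
    have -> : mdist p x ^+ 2 / (2 * tau) * (K * tau) = K / 2 * mdist p x ^+ 2.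
      by field; lra.
    by [].
  by lra.
(* By [resp], [f x - f y] is at least [1 - 1 / (K * tau)] times [f x - f p]. *)
have := lip x y; rewrite ler_norml => /andP[_ fxy].
by rewrite div1r mulrA ler_pdivrMr// mulrBl mul1r [_^-1 * _]mulrC; lra.
Qed.
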